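(* Let $S$ be a square-free semigroup with set of idempotents $E$. Let $D$ be a division ring with center $\mathrm{Cen}(D)=K$ and let $(\alpha,\xi)\in Z^2(S,D)$. Then $R=D^{\alpha}_{\xi}S$ is a $D$-algebra if and only if $[\alpha,\xi]=[1,\zeta]$ for some $\zeta\in Z^2(S,K)$.
   Context: **Square-free semigroups.** A square-free semigroup is a semigroup $S$ (possibly infinite) with zero $\theta$ and a set $E$ of nonzero pairwise orthogonal idempotents such that $S=\bigcup_{e_i,e_j\in E}e_i\cdot S\cdot e_j$ and $|e_i\cdot S\cdot e_j\setminus\{\theta\}|\le 1$ for all $e_i,e_j\in E$. Put $S^*=S\setminus\{\theta\}$; the unique nonzero element of $e_i\cdot S\cdot e_j$, if it exists, is written $s_{ij}$, with $s_{ii}=e_i$. $S^{<n>}$ is the set of $n$-tuples in $S$ with nonzero product. **2-cocycles.** Let $D^*=D\setminus\{0\}$, $\mathrm{Aut}(D)$ the group of ring automorphisms of $D$, $\tau_d(x)=dxd^{-1}$ for $d\in D^*$. $Z^2(S,D)$ is the set of pairs $(\alpha,\xi)$ of functions $\alpha:S^*\to\mathrm{Aut}(D)$, $s_{ij}\mapsto\alpha_{ij}$, and $\xi:S^{<2>}\to D^*$ such that for all $(s_{ij},s_{jk},s_{k\ell})\in S^{<3>}$ $$\alpha_{ij}(\xi(s_{jk},s_{k\ell}))\,\xi(s_{ij},s_{jk}\cdot s_{k\ell})=\xi(s_{ij},s_{jk})\,\xi(s_{ij}\cdot s_{jk},s_{k\ell}),\qquad \alpha_{ij}\circ\alpha_{jk}=\tau_{\xi(s_{ij},s_{jk})}\circ\alpha_{ik}.$$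 For the field $K$, $Z^2(S,K)$ is the group of functions $\zeta:S^{<2>}\to K^*$ with $\zeta(s_{jk},s_{k\ell})\zeta(s_{ij},s_{jk}\cdot s_{k\ell})=\zeta(s_{ij},s_{jk})\zeta(s_{ij}\cdot s_{jk},s_{k\ell})$ whenever $s_{ij}\cdot s_{jk}\cdot s_{k\ell}\neq\theta$. For such $\zeta$ one has $(1,\zeta)\in Z^2(S,D)$, where $1$ denotes the constant function $\alpha_{ij}=1_D$. **Cohomologous cocycles.** $[\alpha,\xi]=[\beta,\zeta]$ means that there are functions $\mu:E\to\mathrm{Aut}(D)$, $e_i\mapsto\mu_i$, and $\eta:S^*\to D^*$ such that $$\beta_{ij}=\mu_i^{-1}\circ\tau_{\eta(s_{ij})}\circ\alpha_{ij}\circ\mu_j\quad(s_{ij}\in S^* ),$$ $$\zeta(s_{ij},s_{jk})=\mu_i^{-1}\big[\eta(s_{ij})\,\alpha_{ij}(\eta(s_{jk}))\,\xi(s_{ij},s_{jk})\,\eta(s_{ij}\cdot s_{jk})^{-1}\big]\quad((s_{ij},s_{jk})\in S^{<2>}).$$ This is an equivalence relation on $Z^2(S,D)$. **The rings.** $D^\alpha_\xi S$ is the left $D$-vector space with basis $S^*$ and biadditive multiplication $(c\,s_{ij})(d\,s_{k\ell})=c\,\alpha_{ij}(d)\,\xi(s_{ij},s_{k\ell})\,s_{i\ell}$ if $s_{ij}\cdot s_{k\ell}\neq\theta$, and $0$ otherwise; it is an associative ring (not necessarily with identity). For $\zeta\in Z^2(S,K)$, $K_\zeta S$ is the $K$-algebra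 with $K$-basis $S^*$ and multiplication $s_{ij}s_{k\ell}=\zeta(s_{ij},s_{k\ell})s_{i\ell}$ if $s_{ij}\cdot s_{k\ell}\ne\theta$ and $0$ otherwise. **$D$-algebra.** The ring $R=D^\alpha_\xi S$ is called a (square-free) $D$-algebra if it is isomorphic, as a ring, to $D\otimes_K A$ for some square-free $K$-algebra $A=K_\zeta S$ with $\zeta\in Z^2(S,K)$, where $K=\mathrm{Cen}(D)$. *)

(* Defs.v *)
From HB Require Import structures.
From mathcomp Require Import all_boot all_algebra.
From mathcomp Require Import boolp finmap monalg.

Set Implicit Arguments.
Unset Strict Implicit.
Unset Printing Implicit Defensive.

Import GRing.Theory.
Local Open Scope ring_scope.
Local Open Scope quotient_scope.

HB.mixin Record UnitRing_isDivisionRing D of GRing.UnitRing D := {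
  division_ringP : forall x : D, x != 0 -> x \is a GRing.unit }.

#[short(type="divisionRingType")]
HB.structure Definition DivisionRing :=
  {D of UnitRing_isDivisionRing D & GRing.UnitRing D}.

(* The inverse is part of the data so that it can be written in formulas; it
   is determined by the underlying morphism. *)
Record ring_aut (D : nzRingType) := RingAut {
  aut_fun :> {rmorphism D -> D};
  aut_inv : D -> D;
  aut_funK : cancel aut_fun aut_inv;
  aut_invK : cancel aut_inv aut_fun }.

Definition ring_aut1 (D : nzRingType) : ring_aut D :=
  @RingAut D idfun id (fun=> erefl) (fun=> erefl).

Definition inner (D : unitRingType) (d x : D) : D := d * x * d^-1.

Section Center.
Variable D : divisionRingType.

Definition central : {pred D} := fun x => `[< forall y : D, GRing.comm x y >].

Lemma centralP x : reflect (forall y : D, GRing.comm x y) (x \in central).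
Proof. exact: asboolP. Qed.

Fact central_divring_closed : divring_closed central.
Proof.
split=> [|x y /centralP xC /centralP yC|x y /centralP xC /centralP yC].
- by apply/centralP=> y; apply/commr_sym/commr1.
- by apply/centralP=> z; apply/commr_sym/commrB; apply: commr_sym.
- apply/centralP=> z; apply/commr_sym/commrM; first exact: commr_sym.
  exact/commrV/commr_sym.
Qed.

HB.instance Definition _ :=
  GRing.isDivringClosed.Build D central central_divring_closed.

Record center := Center { center_val :> D; _ : center_val \in central }.

HB.instance Definition _ := [isSub for center_val].
HB.instance Definition _ := [Choice of center by <:].
HB.instance Definition _ := [SubChoice_isSubUnitRing of center by <:].

Fact center_mulC : commutative (@GRing.mul center).
Proof. by move=> x y; apply/val_inj/(centralP _ (valP x)). Qed.

HB.instance Definition _ :=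
  GRing.PzRing_hasCommutativeMul.Build center center_mulC.

Fact center_field : GRing.field_axiom center.
Proof. by move=> x x_neq0; rewrite unfold_in /= division_ringP. Qed.

HB.instance Definition _ := GRing.ComUnitRing_isField.Build center center_field.

End Center.


Section Bilinear.
Variables (I J : choiceType) (G H V : zmodType).

(* The biadditive map on finitely supported families that sends the pair of
   monomials (<< c *g s >>, << d *g t >>) to F s c t d. *)
Definition bilinear_ext (F : I -> G -> J -> H -> V)
    (x : {malg G[I]}) (y : {malg H[J]}) : V :=
  \sum_(s <- msupp x) \sum_(t <- msupp y) F s x@_s t y@_t.

Variable F : I -> G -> J -> H -> V.
Hypothesis FDl : forall s t d, zmod_morphism (fun c => F s c t d).
Hypothesis FDr : forall s c t, zmod_morphism (F s c t).

Let F0l s t d : F s 0 t d = 0.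
Proof. by have := FDl s t d 0 0; rewrite !subrr. Qed.

Let F0r s c t : F s c t 0 = 0.
Proof. by have := FDr s c t 0 0; rewrite !subrr. Qed.

Lemma bilinear_extw (A : {fset I}) (B : {fset J}) x y :
    (msupp x `<=` A)%fset -> (msupp y `<=` B)%fset ->
  bilinear_ext F x y = \sum_(s <- A) \sum_(t <- B) F s x@_s t y@_t.
Proof.
move=> xA yB; rewrite /bilinear_ext (big_fset_incl _ xA) /=.
  by apply: eq_bigr=> s _; apply: big_fset_incl=> // t _ /mcoeff_outdom->.
by move=> s _ /mcoeff_outdom xs; rewrite big1 // => t _; rewrite xs F0l.
Qed.

Lemma bilinear_extBl y : zmod_morphism ((bilinear_ext F)^~ y).
Proof.
move=> x x'; pose A := (msupp x `|` msupp x')%fset.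
have [sB sx sx'] : [/\ (msupp (x - x') `<=` A)%fset,
   (msupp x `<=` A)%fset & (msupp x' `<=` A)%fset].
  by rewrite msuppB_le fsubsetUl fsubsetUr.
rewrite !(@bilinear_extw A (msupp y)) ?fsubset_refl // -sumrB.
apply: eq_bigr=> s _; rewrite -sumrB; apply: eq_bigr=> t _.
by rewrite mcoeffB FDl.
Qed.

Lemma bilinear_extBr x : zmod_morphism (bilinear_ext F x).
Proof.
move=> y y'; pose B := (msupp y `|` msupp y')%fset.
have [sB sy sy'] : [/\ (msupp (y - y') `<=` B)%fset,
   (msupp y `<=` B)%fset & (msupp y' `<=` B)%fset].
  by rewrite msuppB_le fsubsetUl fsubsetUr.
rewrite !(@bilinear_extw (msupp x) B) ?fsubset_refl // -sumrB.
apply: eq_bigr=> s _; rewrite -sumrB; apply: eq_bigr=> t _.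
by rewrite mcoeffB FDr.
Qed.

Lemma bilinear_extUU s c t d :
  bilinear_ext F << c *g s >> << d *g t >> = F s c t d.
Proof.
by rewrite (bilinear_extw msuppU_le msuppU_le) !big_seq_fset1 !mcoeffUU.
Qed.

End Bilinear.

Section SquareFreeSemigroup.
Local Open Scope group_scope.
Variables (S : semigroupType) (theta : S) (E : {pred S}).

Definition corner (e f s : S) : Prop := exists x, s = e * x * f.

Record square_free_semigroup : Prop := SquareFreeSemigroup {
  sqf_mul0s : forall s, theta * s = theta;
  sqf_muls0 : forall s, s * theta = theta;
  sqf_idem : {in E, forall e, e * e = e};
  sqf_neq0 : {in E, forall e, e != theta};
  sqf_orth : {in E &, forall e f, e != f -> e * f = theta};
  sqf_cover : forall s, exists e f, [/\ e \in E, f \in E & corner e f s];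
  sqf_le1 : {in E &, forall e f s t, corner e f s -> corner e f t ->
               s != theta -> t != theta -> s = t} }.

Definition nonzero : Type := {s : S | s != theta}.

HB.instance Definition _ := Choice.on nonzero.

End SquareFreeSemigroup.

(* Functions on the nonzero elements of S, on the pairs with nonzero product
   and on E are represented by total functions on S (or S * S); only their
   values at the intended arguments are ever used.  In the formulas below s, t
   and u stand for s_ij, s_jk and s_kl, so that alpha_ik is alpha (s * t). *)
Section Cocycles.
Variables (S : semigroupType) (theta : S) (E : {pred S}).

Section DivisionRing.
Variable D : divisionRingType.

Record cocycle2 (alpha : S -> ring_aut D) (xi : S -> S -> D) : Prop := {
  cocycle2_neq0 : forall s t, (s * t)%g != theta -> xi s t != 0;
  cocycle2_mul : forall s t u, (s * t * u)%g != theta ->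
    alpha s (xi t u) * xi s (t * u)%g = xi s t * xi (s * t)%g u;
  cocycle2_aut : forall s t u, (s * t * u)%g != theta ->
    alpha s \o alpha t =1 inner (xi s t) \o alpha (s * t)%g }.

Definition cohomologous (alpha : S -> ring_aut D) (xi : S -> S -> D)
    (beta : S -> ring_aut D) (zeta : S -> S -> D) : Prop :=
  exists (mu : S -> ring_aut D) (eta : S -> D),
    [/\ forall s, s != theta -> eta s != 0,
        forall i j s, i \in E -> j \in E -> corner i j s -> s != theta ->
          beta s =1 aut_inv (mu i) \o inner (eta s) \o alpha s \o mu j
      & forall i j k s t, i \in E -> j \in E -> k \in E ->
          corner i j s -> corner j k t -> (s * t)%g != theta ->
          zeta s t =
            aut_inv (mu i) (eta s * alpha s (eta t) * xi s t / eta (s * t)%g)].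

End DivisionRing.

Record cocycle2_field (K : fieldType) (zeta : S -> S -> K) : Prop := {
  cocycle2_field_neq0 : forall s t, (s * t)%g != theta -> zeta s t != 0;
  cocycle2_field_mul : forall s t u, (s * t * u)%g != theta ->
    zeta t u * zeta s (t * u)%g = zeta s t * zeta (s * t)%g u }.

Lemma cocycle2_center (D : divisionRingType) (zeta : S -> S -> center D) :
    square_free_semigroup theta E -> cocycle2_field zeta ->
  cocycle2 (fun=> ring_aut1 D) (fun s t => val (zeta s t)).
Proof.
move=> sqfS [zeta0 zetaM].
have zeta_neq0 s t : (s * t)%g != theta -> val (zeta s t) != 0.
  by move/zeta0; apply: contra_neq => z0; apply: val_inj.
split=> [//|s t u /zetaM/(congr1 val)//|s t u stu x].
have st0 : (s * t)%g != theta.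
  by apply: contra_neq stu => ->; apply: (sqf_mul0s sqfS).
rewrite /inner /= (centralP _ (valP (zeta s t))) mulrK //.
exact/division_ringP/zeta_neq0.
Qed.

End Cocycles.

Section TwistedSemigroupRing.
Variables (S : semigroupType) (theta : S).

(* The multiplication of the left R-module {malg R[nonzero theta]} given by
   (c s) (d t) = c (alpha s d) (xi s t) (s t), or 0 if s t is zero. *)
Definition twisted_mul (R : nzRingType) (alpha : S -> R -> R) (xi : S -> S -> R)
    : {malg R[nonzero theta]} -> {malg R[nonzero theta]} ->
      {malg R[nonzero theta]} :=
  bilinear_ext (fun s c t d =>
    if insub (val s * val t)%g is Some u
    then << c * alpha (val s) d * xi (val s) (val t) *g u >> else 0).

Definition sqf_ring_mul (D : divisionRingType) (alpha : S -> ring_aut D)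
    (xi : S -> S -> D) := twisted_mul (fun s => alpha s) xi.

Definition sqf_algebra_mul (K : fieldType) (zeta : S -> S -> K) :=
  twisted_mul (fun _ => id) zeta.

Section TwistedMulTheory.
Variables (R : nzRingType) (alpha : S -> {additive R -> R}) (xi : S -> S -> R).
Let mul := twisted_mul (fun s => alpha s) xi.

Lemma twisted_FDl (s : nonzero theta) (t : nonzero theta) (d : R) :
  zmod_morphism (fun c => if insub (val s * val t)%g is Some u
    then << c * alpha (val s) d * xi (val s) (val t) *g u >>
    else 0 : {malg R[nonzero theta]}).
Proof.
by move=> c c' /=; case: insub => [u|]; rewrite ?subr0 // !mulrBl monalgUB.
Qed.

Lemma twisted_FDr (s : nonzero theta) (c : R) (t : nonzero theta) :
  zmod_morphism (fun d => if insub (val s * val t)%g is Some u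
    then << c * alpha (val s) d * xi (val s) (val t) *g u >>
    else 0 : {malg R[nonzero theta]}).
Proof.
move=> d d' /=; case: insub => [u|]; rewrite ?subr0 //.
by rewrite raddfB mulrBr mulrBl monalgUB.
Qed.

Lemma twisted_mulBl y : zmod_morphism (mul^~ y).
Proof. exact: (bilinear_extBl twisted_FDl twisted_FDr). Qed.

Lemma twisted_mulBr x : zmod_morphism (mul x).
Proof. exact: (bilinear_extBr twisted_FDl twisted_FDr). Qed.

Lemma twisted_mulUU (s t : nonzero theta) c d :
  mul << c *g s >> << d *g t >> =
    if insub (val s * val t)%g is Some u
    then << c * alpha (val s) d * xi (val s) (val t) *g u >> else 0.
Proof. exact: (bilinear_extUU twisted_FDl twisted_FDr). Qed.

End TwistedMulTheory.

Section AlgebraTheory.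
Variables (K : fieldType) (zeta : S -> S -> K).
Implicit Types x y : {malg K[nonzero theta]}.
Let alpha (s : S) : {additive K -> K} := idfun.

Lemma sqf_algebra_mulBl y : zmod_morphism ((sqf_algebra_mul zeta)^~ y).
Proof. exact: (twisted_mulBl alpha). Qed.

Lemma sqf_algebra_mulBr x : zmod_morphism (sqf_algebra_mul zeta x).
Proof. exact: (twisted_mulBr alpha). Qed.

Lemma sqf_algebra_mulZl k x y :
  sqf_algebra_mul zeta (k *: x) y = k *: sqf_algebra_mul zeta x y.
Proof.
rewrite /sqf_algebra_mul /twisted_mul.
rewrite (@bilinear_extw _ _ _ _ _ _ (twisted_FDl alpha zeta)
  (twisted_FDr alpha zeta) (msupp x) (msupp y)) ?msuppZ_le ?fsubset_refl //.
rewrite /bilinear_ext scaler_sumr; apply: eq_bigr=> s _.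
rewrite scaler_sumr; apply: eq_bigr=> t _.
case: insub => [u|]; rewrite ?scaler0 // mcoeffZ -!mulrA.
by apply/malgP=> v; rewrite mcoeffZ !mcoeffU mulrnAr.
Qed.

Lemma sqf_algebra_mulZr k x y :
  sqf_algebra_mul zeta x (k *: y) = k *: sqf_algebra_mul zeta x y.
Proof.
rewrite /sqf_algebra_mul /twisted_mul.
rewrite (@bilinear_extw _ _ _ _ _ _ (twisted_FDl alpha zeta)
  (twisted_FDr alpha zeta) (msupp x) (msupp y)) ?msuppZ_le ?fsubset_refl //.
rewrite /bilinear_ext scaler_sumr; apply: eq_bigr=> s _.
rewrite scaler_sumr; apply: eq_bigr=> t _.
case: insub => [u|]; rewrite ?scaler0 // mcoeffZ mulrCA -!mulrA.
by apply/malgP=> v; rewrite mcoeffZ !mcoeffU mulrnAr.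
Qed.

End AlgebraTheory.

End TwistedSemigroupRing.

(* Tensor product over the center of D of D and a (not necessarily unital)
   algebra A, with multiplication mulA: the free abelian group on D * A modulo
   the subgroup generated by the usual relations. *)
Section Tensor.
Variables (D : divisionRingType) (A : lmodType (center D)).
Local Notation free := {malg int[(D * A)%type]}.

Inductive tensor_null : free -> Prop :=
| tensor_null0 : tensor_null 0
| tensor_nullB x y : tensor_null x -> tensor_null y -> tensor_null (x - y)
| tensor_nullDl (d d' : D) (a : A) :
    tensor_null (<< (d + d', a) >> - << (d, a) >> - << (d', a) >>)
| tensor_nullDr (d : D) (a a' : A) :
    tensor_null (<< (d, a + a') >> - << (d, a) >> - << (d, a') >>)
| tensor_nullZ (d : D) (k : center D) (a : A) :
    tensor_null (<< (d * val k, a) >> - << (d, k *: a) >>).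

Definition tensor_ideal : {pred free} :=
  fun x => `[< tensor_null x >].

Fact tensor_ideal_closed : zmod_closed tensor_ideal.
Proof.
split=> [|x y /asboolP x0 /asboolP y0]; apply/asboolP; first exact: tensor_null0.
exact: tensor_nullB.
Qed.

HB.instance Definition _ :=
  GRing.isZmodClosed.Build _ tensor_ideal tensor_ideal_closed.

Definition tensor : zmodType := {ideal_quot tensor_ideal}.

Definition tens (d : D) (a : A) : tensor :=
  \pi_{ideal_quot tensor_ideal} << (d, a) >>.

Variable mulA : A -> A -> A.

Definition tensor_free_mul : free -> free -> free :=
  bilinear_ext (fun p m q n => << m * n *g (p.1 * q.1, mulA p.2 q.2) >>).

Definition tensor_mul (x y : tensor) : tensor :=
  \pi_{ideal_quot tensor_ideal} (tensor_free_mul (repr x) (repr y)).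

Lemma tensor_eq (x y : free) : tensor_null (x - y) ->
  \pi_{ideal_quot tensor_ideal} x = \pi y.
Proof. by move=> xy; apply/eqP; rewrite -Quotient.idealrBE; apply/asboolP. Qed.

Lemma tensDl d d' a : tens (d + d') a = tens d a + tens d' a.
Proof.
rewrite -[RHS]pi_addr; apply: tensor_eq.
by rewrite opprD addrA; apply: tensor_nullDl.
Qed.

Lemma tensDr d a a' : tens d (a + a') = tens d a + tens d a'.
Proof.
rewrite -[RHS]pi_addr; apply: tensor_eq.
by rewrite opprD addrA; apply: tensor_nullDr.
Qed.

Lemma tensZ d (k : center D) a : tens (d * val k) a = tens d (k *: a).
Proof. exact/tensor_eq/tensor_nullZ. Qed.

Hypothesis mulABl : forall b, zmod_morphism (mulA^~ b).
Hypothesis mulABr : forall a, zmod_morphism (mulA a).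
Hypothesis mulAZl : forall k a b, mulA (k *: a) b = k *: mulA a b.
Hypothesis mulAZr : forall k a b, mulA a (k *: b) = k *: mulA a b.

Let FDl (p q : D * A) (n : int) :
  zmod_morphism (fun m => << m * n *g (p.1 * q.1, mulA p.2 q.2) >> : free).
Proof. by move=> m m' /=; rewrite mulrBl monalgUB. Qed.

Let FDr (p : D * A) (m : int) (q : D * A) :
  zmod_morphism (fun n => << m * n *g (p.1 * q.1, mulA p.2 q.2) >> : free).
Proof. by move=> n n' /=; rewrite mulrBr monalgUB. Qed.

Let fmulBl y : zmod_morphism (tensor_free_mul^~ y).
Proof. exact: (bilinear_extBl FDl FDr). Qed.

Let fmulBr x : zmod_morphism (tensor_free_mul x).
Proof. exact: (bilinear_extBr FDl FDr). Qed.

Let fmulUU p q : tensor_free_mul << p >> << q >> =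
  << (p.1 * q.1, mulA p.2 q.2) >>.
Proof. by rewrite /tensor_free_mul (bilinear_extUU FDl FDr) mulr1. Qed.

Let nullN x : tensor_null x -> tensor_null (- x).
Proof. by move=> x0; rewrite -sub0r; apply: tensor_nullB (tensor_null0) x0. Qed.

Let nullD x y : tensor_null x -> tensor_null y -> tensor_null (x + y).
Proof. by move=> x0 y0; rewrite -[y]opprK; apply/tensor_nullB/nullN. Qed.

Let null_morph (f : free -> free) : zmod_morphism f ->
  (forall p, tensor_null (f << p >>)) -> forall x, tensor_null (f x).
Proof.
move=> fB fU x.
pose fM := GRing.isZmodMorphism.Build _ _ f fB.
pose f' : {additive free -> free} := HB.pack f fM.
rewrite (monalgE x) -[f]/(f' : _ -> _) raddf_sum.
elim/big_ind: _ => [||p _]; [exact: tensor_null0|exact: nullD|].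
have nullMn n : tensor_null (f' << p >> *+ n).
  by elim: n => [|n IHn]; [exact: tensor_null0|rewrite mulrS; apply: nullD].
have -> : << x@_p *g p >> = << p >> *~ x@_p :> free.
  by apply/malgP=> q; rewrite -(raddfMz (mkmalgU p)) /= intz.
rewrite raddfMz; case: (x@_p) => n; [exact: nullMn|exact/nullN/nullMn].
Qed.

Let fmul_null_l x y : tensor_null x -> tensor_null (tensor_free_mul x y).
Proof.
move=> x0; move: y; apply: null_morph => // -[d'' a''].
have mB := fmulBl << (d'', a'') >>.
elim: x0 => [|x1 x2 _ IHx _ IHy|d d' a|d a a'|d k a].
- by rewrite -(subrr 0) mB subrr; apply: tensor_null0.
- by rewrite mB; apply: tensor_nullB.
- by rewrite !mB !fmulUU /= mulrDl; apply: tensor_nullDl.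
- rewrite !mB !fmulUU /=; have -> : mulA (a + a') a'' = mulA a a'' + mulA a' a''.
    by apply/eqP; rewrite -subr_eq -mulABl addrK.
  exact: tensor_nullDr.
- rewrite mB !fmulUU /= mulAZl -mulrA (centralP _ (valP k)) mulrA.
  exact: tensor_nullZ.
Qed.

Let fmul_null_r x y : tensor_null y -> tensor_null (tensor_free_mul x y).
Proof.
move=> y0; move: x; apply: (@null_morph (tensor_free_mul^~ y)) => // -[d'' a''].
have mB := fmulBr << (d'', a'') >>.
elim: y0 => [|x1 x2 _ IHx _ IHy|d d' a|d a a'|d k a].
- by rewrite -(subrr 0) mB subrr; apply: tensor_null0.
- by rewrite mB; apply: tensor_nullB.
- by rewrite !mB !fmulUU /= mulrDr; apply: tensor_nullDl.
- rewrite !mB !fmulUU /=; have -> : mulA a'' (a + a') = mulA a'' a + mulA a'' a'.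
    by apply/eqP; rewrite -subr_eq -mulABr addrK.
  exact: tensor_nullDr.
- by rewrite mB !fmulUU /= mulAZr mulrA; apply: tensor_nullZ.
Qed.

Lemma tensor_mul_pi (x y : free) :
  tensor_mul (\pi x) (\pi y) =
    \pi_{ideal_quot tensor_ideal} (tensor_free_mul x y).
Proof.
have null_repr (z : free) :
    tensor_null (repr (\pi_{ideal_quot tensor_ideal} z) - z).
  suff /asboolP : repr (\pi_{ideal_quot tensor_ideal} z) - z \in tensor_ideal.
    by [].
  by rewrite Quotient.idealrBE reprK.
apply: tensor_eq; set x' := repr _; set y' := repr _.
rewrite -(subrK (tensor_free_mul x y') (tensor_free_mul x' y')) -addrA.
rewrite -fmulBl -fmulBr.
by apply: nullD; [apply: fmul_null_l|apply: fmul_null_r]; apply: null_repr.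
Qed.

Lemma tensor_mul_tens d d' a a' :
  tensor_mul (tens d a) (tens d' a') = tens (d * d') (mulA a a').
Proof. by rewrite tensor_mul_pi fmulUU. Qed.

Lemma tensor_mulBl y : zmod_morphism (tensor_mul^~ y).
Proof.
move=> x x'; rewrite -[x]reprK -[x']reprK -[y]reprK.
by rewrite -raddfB !tensor_mul_pi fmulBl raddfB.
Qed.

Lemma tensor_mulBr x : zmod_morphism (tensor_mul x).
Proof.
move=> y y'; rewrite -[x]reprK -[y]reprK -[y']reprK.
by rewrite -raddfB !tensor_mul_pi fmulBr raddfB.
Qed.

End Tensor.

Definition rng_isomorphic (V W : zmodType)
    (mulV : V -> V -> V) (mulW : W -> W -> W) : Prop :=
  exists f : {additive V -> W},
    bijective f /\ {morph f : x y / mulV x y >-> mulW x y}.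

Definition is_D_algebra (S : semigroupType) (theta : S) (D : divisionRingType)
    (alpha : S -> ring_aut D) (xi : S -> S -> D) : Prop :=
  exists zeta : S -> S -> center D,
    cocycle2_field theta zeta /\
    rng_isomorphic (@sqf_ring_mul S theta D alpha xi)
      (tensor_mul (@sqf_algebra_mul S theta (center D) zeta)).

(* Main.v *)
Require Import Defs.
From HB Require Import structures.
From mathcomp Require Import all_boot all_algebra.
From mathcomp Require Import boolp finmap monalg.

Set Implicit Arguments.
Unset Strict Implicit.
Unset Printing Implicit Defensive.

Import GRing.Theory.
Local Open Scope ring_scope.

(** Write R for the ring D^alpha_xi S.  The tensor product of D and K_zeta S is
    the twisted ring D^1_zeta S ([tensor_iso]), so the question is when R is
    isomorphic to a ring D^1_zeta S.  More generally, let R' = D^beta_zeta S.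

    If (alpha, xi) and (beta, zeta) are cohomologous through mu and eta, put
    nu_i = mu_i^-1 and h_s = nu_i (eta s)^-1 for s in e_i S e_j.  The two
    conditions of cohomology become the equations of [intertwining], and these
    say that c s |-> nu_i(c) h_s s is multiplicative.  This map is then a ring
    isomorphism from R to R' ([intertwining_iso]).

    Conversely let phi : R -> R' be an isomorphism.  Write eps_i and eps'_i for
    the identities of the corners of e_i in R and in R'; the corner
    eps_i R eps_i is a copy of D.  Hence f = phi(eps_i) is a nonzero idempotent
    of R' for which f R' f is a division ring.  As R' has local units,
    f eps'_k f <> 0 for some k; it is invertible in f R' f, and this yields u_i
    and v_i with u_i v_i = f and v_i u_i = eps'_k ([corner_transfer_exists]).
    Put k = sigma(i).  The maps x |-> v_i phi(x) u_j, from eps_i R eps_j to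
    eps'_sigma(i) R' eps'_sigma(j), respect products.  They are automorphisms
    nu_i of D on the diagonal corners ([transfer_aut]), and as all corners have
    dimension at most 1 over D, they send s in S^* to a multiple h_s p(s) of an
    element p(s) of S^*.  Multiplicativity says that p(s) p(t) = p(s t) whenever
    s t is nonzero, and that nu and h intertwine (alpha, xi) with
    (beta o p, zeta o p) ([iso_pullback]).

    When beta is trivial so is beta o p, and zeta o p is again a cocycle with
    values in K because p preserves nonzero products. *)

(** * Additive maps on finitely supported families *)

Lemma addrK2 (V : zmodType) (x y : V) : x + y - x - y = 0.
Proof. by rewrite -addrA -opprD subrr. Qed.

Section AdditiveMaps.
Variables (V W : zmodType) (f : V -> W).
Hypothesis fB : zmod_morphism f.

Lemma zmod_morph0 : f 0 = 0.
Proof. by rewrite -[0 in LHS](subrr 0) fB subrr. Qed.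

Lemma zmod_morphN : {morph f : x / - x}.
Proof. by move=> x; rewrite -(sub0r x) fB zmod_morph0 sub0r. Qed.

Lemma zmod_morphD : {morph f : x y / x + y}.
Proof. by move=> x y; rewrite -{1}[y]opprK fB zmod_morphN opprK. Qed.

Lemma zmod_morph_sum I (s : seq I) (F : I -> V) :
  f (\sum_(i <- s) F i) = \sum_(i <- s) f (F i).
Proof. exact: (big_morph f zmod_morphD zmod_morph0). Qed.

End AdditiveMaps.

Lemma zmod_morph_comp (U V W : zmodType) (g : V -> W) (f : U -> V) :
  zmod_morphism g -> zmod_morphism f -> zmod_morphism (g \o f).
Proof. by move=> gB fB x y /=; rewrite fB gB. Qed.

Section LinearExtension.
Variables (I : choiceType) (G V : zmodType).

Lemma malg_ind (P : {malg G[I]} -> Prop) :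
    P 0 -> (forall x y, P x -> P y -> P (x + y)) ->
    (forall c i, P << c *g i >>) -> forall x, P x.
Proof. by move=> P0 PD PU x; rewrite (monalgE x); elim/big_ind: _. Qed.

Lemma malg_morph_ext (f g : {malg G[I]} -> V) :
    zmod_morphism f -> zmod_morphism g ->
  (forall c i, f << c *g i >> = g << c *g i >>) -> f =1 g.
Proof.
move=> fB gB fg; elim/malg_ind=> [|x y fx fy|//].
  by rewrite !zmod_morph0.
by rewrite !zmod_morphD // fx fy.
Qed.

Variable F : I -> G -> V.

Definition linear_ext (x : {malg G[I]}) : V := \sum_(i <- msupp x) F i x@_i.

Hypothesis FB : forall i, zmod_morphism (F i).

Lemma linear_extw (A : {fset I}) x : (msupp x `<=` A)%fset ->
  linear_ext x = \sum_(i <- A) F i x@_i.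
Proof.
move=> xA; apply: big_fset_incl => // i _ /mcoeff_outdom->.
exact: zmod_morph0.
Qed.

Lemma linear_extB : zmod_morphism linear_ext.
Proof.
move=> x y; pose A := (msupp x `|` msupp y)%fset.
rewrite !(@linear_extw A) ?msuppB_le ?fsubsetUl ?fsubsetUr // -sumrB.
by apply: eq_bigr => i _; rewrite mcoeffB FB.
Qed.

Lemma linear_extU c i : linear_ext << c *g i >> = F i c.
Proof. by rewrite (linear_extw msuppU_le) big_seq_fset1 mcoeffUU. Qed.

End LinearExtension.

(** * Isomorphisms of rings without identity *)

Section Isomorphisms.
Variables (V W : zmodType) (mulV : V -> V -> V) (mulW : W -> W -> W).

Lemma rng_isomorphic_intro (f : V -> W) (g : W -> V) :
    zmod_morphism f -> cancel f g -> cancel g f ->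
    {morph f : x y / mulV x y >-> mulW x y} ->
  rng_isomorphic mulV mulW.
Proof.
move=> fB fK gK fM; pose fA := GRing.isZmodMorphism.Build _ _ f fB.
exists (HB.pack f fA : {additive V -> W}); split=> //.
by exists g.
Qed.

Lemma rng_isomorphic_inv : rng_isomorphic mulV mulW ->
  exists (f : V -> W) (g : W -> V), [/\ zmod_morphism f, zmod_morphism g,
    cancel f g, cancel g f & {morph f : x y / mulV x y >-> mulW x y}].
Proof.
case=> f [[g fK gK] fM]; exists f, g; split=> //; first exact: raddfB.
exact: can2_zmod_morphism fK gK.
Qed.

End Isomorphisms.

Lemma rng_isomorphic_sym (V W : zmodType) mulV mulW :
  @rng_isomorphic V W mulV mulW -> rng_isomorphic mulW mulV.
Proof.
move/rng_isomorphic_inv=> [f [g [fB gB fK gK fM]]].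
apply: (rng_isomorphic_intro gB gK fK) => x y.
by apply: (can_inj fK); rewrite fM !gK.
Qed.

Lemma rng_isomorphic_trans (U V W : zmodType) mulU mulV mulW :
    @rng_isomorphic U V mulU mulV -> @rng_isomorphic V W mulV mulW ->
  rng_isomorphic mulU mulW.
Proof.
move=> /rng_isomorphic_inv[f [f' [fB _ fK f'K fM]]].
move=> /rng_isomorphic_inv[g [g' [gB _ gK g'K gM]]].
apply: (rng_isomorphic_intro (zmod_morph_comp gB fB) (can_comp gK fK)
  (can_comp f'K g'K)) => x y /=.
by rewrite fM gM.
Qed.

(** * The tensor product of D and a twisted semigroup algebra over its center *)

Section TensorBasis.
Variables (D : divisionRingType) (A : lmodType (center D)).

Lemma tensZmod_l a : zmod_morphism (fun d : D => tens d a : tensor A).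
Proof. by move=> c d /=; apply/eqP; rewrite eq_sym subr_eq -tensDl subrK. Qed.

Lemma tensZmod_r (d : D) : zmod_morphism (fun a => tens d a : tensor A).
Proof. by move=> a b /=; apply/eqP; rewrite eq_sym subr_eq -tensDr subrK. Qed.

Lemma tensor_ind (P : tensor A -> Prop) :
    P 0 -> (forall x y, P x -> P y -> P (x - y)) ->
    (forall d a, P (tens d a)) -> forall x, P x.
Proof.
move=> P0 PB Pt x.
have PN y : P y -> P (- y) by move=> Py; rewrite -sub0r; apply: PB.
have PD y z : P y -> P z -> P (y + z).
  by move=> Py Pz; rewrite -[z]opprK; apply/PB/PN.
rewrite -[x]reprK; move: (repr x); elim/malg_ind => [|y z Py Pz|n [d a]].
- by rewrite raddf0.
- by rewrite raddfD; apply: PD.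
have -> : << n *g (d, a) >> = << (d, a) >> *~ n :> {malg int[(D * A)%type]}.
  by rewrite -(raddfMz (mkmalgU (d, a))) /= intz.
rewrite raddfMz -/(tens d a).
have PMn m : P (tens d a *+ m).
  by elim: m => [|m IHm]; [exact: P0|rewrite mulrS; apply: PD].
by case: n => n; [exact: PMn|exact/PN/PMn].
Qed.

(** The universal property: the additive extension of f to the free group kills
    the defining relations, so it may be computed on any representative. *)
Lemma tensor_lift (W : zmodType) (f : D -> A -> W) :
    (forall d d' a, f (d + d') a = f d a + f d' a) ->
    (forall d a a', f d (a + a') = f d a + f d a') ->
    (forall d (k : center D) a, f (d * val k) a = f d (k *: a)) ->
  exists g : tensor A -> W,
    zmod_morphism g /\ forall d a, g (tens d a) = f d a.
Proof.
move=> fDl fDr fZ; pose F (p : D * A) (n : int) : W := f p.1 p.2 *~ n.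
have FB p : zmod_morphism (F p) by move=> m n; rewrite /F mulrzBr.
pose h : {malg int[(D * A)%type]} -> W := linear_ext F.
have hB : zmod_morphism h := linear_extB FB.
have hU d a : h << (d, a) >> = f d a by rewrite /h linear_extU.
have h0 z : tensor_null z -> h z = 0.
  elim=> [|x y _ x0 _ y0|d d' a|d a a'|d k a].
  - exact: (zmod_morph0 hB).
  - by rewrite hB x0 y0 subrr.
  - by rewrite 2!hB !hU fDl addrK2.
  - by rewrite 2!hB !hU fDr addrK2.
  - by rewrite hB !hU fZ subrr.
pose g (x : tensor A) : W := h (repr x).
have gpi z : g (\pi_({ideal_quot @tensor_ideal D A})%qT z) = h z.
  apply/eqP; rewrite -subr_eq0 -hB; apply/eqP/h0.
  suff /asboolP : repr (\pi_({ideal_quot @tensor_ideal D A})%qT z) - z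
    \in @tensor_ideal D A by [].
  by rewrite Quotient.idealrBE reprK.
exists g; split=> [x y|d a]; last by rewrite gpi hU.
by rewrite -[x]reprK -[y]reprK -raddfB !gpi hB.
Qed.

End TensorBasis.

Section TensorAlgebra.
Variables (S : semigroupType) (theta : S) (D : divisionRingType).
Variable zeta : S -> S -> center D.

Local Notation K := (center D).
Local Notation A := {malg K[nonzero theta]}.
Local Notation DS := {malg D[nonzero theta]}.
Local Notation mulA := (@sqf_algebra_mul S theta K zeta).
Local Notation mulT := (tensor_mul mulA).
Local Notation mulD :=
  (@sqf_ring_mul S theta D (fun=> ring_aut1 D) (fun s t => val (zeta s t))).

Definition to_tensor : DS -> tensor A :=
  linear_ext (fun s d => tens d << s >>).

(** The map a |-> d a, where the coefficients of a are read in D. *)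
Definition scalar_ext (d : D) : A -> DS :=
  linear_ext (fun s (k : K) => << d * val k *g s >>).

Lemma to_tensorB : zmod_morphism to_tensor.
Proof. by apply: linear_extB => s; apply: tensZmod_l. Qed.

Lemma to_tensorU d s : to_tensor << d *g s >> = tens d << s >>.
Proof. by apply: linear_extU => t; apply: tensZmod_l. Qed.

Lemma scalar_ext_coefB (d : D) (s : nonzero theta) :
  zmod_morphism (fun k : K => << d * val k *g s >> : DS).
Proof. by move=> k l; rewrite -monalgUB -mulrBr. Qed.

Lemma scalar_extB d : zmod_morphism (scalar_ext d).
Proof. by apply: linear_extB => s; apply: scalar_ext_coefB. Qed.

Lemma scalar_ext0 d : scalar_ext d 0 = 0.
Proof. exact: (zmod_morph0 (scalar_extB d)). Qed.

Lemma scalar_extD d a b :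
  scalar_ext d (a + b) = scalar_ext d a + scalar_ext d b.
Proof. exact: (zmod_morphD (scalar_extB d)). Qed.

Lemma scalar_extU d k s : scalar_ext d << k *g s >> = << d * val k *g s >>.
Proof. by apply: linear_extU => t; apply: scalar_ext_coefB. Qed.

Lemma scalar_extDl d d' a :
  scalar_ext (d + d') a = scalar_ext d a + scalar_ext d' a.
Proof.
elim/malg_ind: a => [|a b IHa IHb|k s].
- by rewrite !scalar_ext0 addr0.
- rewrite 3!scalar_extD IHa IHb; exact: (addrACA (scalar_ext d a)).
- by rewrite !scalar_extU mulrDl monalgUD.
Qed.

Lemma scalar_extZ d (k : K) a :
  scalar_ext (d * val k) a = scalar_ext d (k *: a).
Proof.
elim/malg_ind: a => [|a b IHa IHb|l s].
- by rewrite scaler0 !scalar_ext0.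
- by rewrite scalerDr !scalar_extD IHa IHb.
have -> : k *: << l *g s >> = << k * l *g s >> :> A.
  by apply/malgP=> t; rewrite mcoeffZ !mcoeffU mulrnAr.
by rewrite !scalar_extU /= mulrA.
Qed.

Lemma of_tensor_exists : exists g : tensor A -> DS,
  zmod_morphism g /\ forall d a, g (tens d a) = scalar_ext d a.
Proof.
apply: (@tensor_lift D A DS scalar_ext).
- exact: scalar_extDl.
- exact: scalar_extD.
- exact: scalar_extZ.
Qed.

(** Both sides are free over D on S^*: the map d s |-> d (x) s has the inverse
    d (x) a |-> d a.  Products correspond because zeta is central and can be
    moved across the tensor sign. *)
Lemma tensor_iso : rng_isomorphic mulD mulT.
Proof.
have [g [gB gE]] := of_tensor_exists.
apply: (rng_isomorphic_intro (g := g) to_tensorB) => [||x y].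
- apply: (@malg_morph_ext _ _ _ _ idfun (zmod_morph_comp gB to_tensorB)).
    by [].
  by move=> d s /=; rewrite to_tensorU gE scalar_extU mulr1.
- have TB := zmod_morph_comp to_tensorB gB.
  elim/tensor_ind => [|x y xK yK|d a].
  + exact: (zmod_morph0 TB).
  + by have /= -> := TB x y; rewrite xK yK.
  rewrite gE; elim/malg_ind: a => [|a b aK bK|k s].
  + rewrite scalar_ext0 (zmod_morph0 to_tensorB); symmetry.
    exact: (zmod_morph0 (tensZmod_r _)).
  + rewrite scalar_extD (zmod_morphD to_tensorB) aK bK; symmetry.
    exact: tensDr.
  + rewrite scalar_extU to_tensorU tensZ; congr tens.
    by apply/malgP=> t; rewrite mcoeffZ !mcoeffU mulrnAr mulr1.
- have mulDBl z : zmod_morphism (mulD^~ z) :=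
    twisted_mulBl (fun=> idfun) (fun s t => val (zeta s t)) z.
  have mulDBr z : zmod_morphism (mulD z) :=
    twisted_mulBr (fun=> idfun) (fun s t => val (zeta s t)) z.
  have mulABl := @sqf_algebra_mulBl S theta K zeta.
  have mulABr := @sqf_algebra_mulBr S theta K zeta.
  have mulAZl := @sqf_algebra_mulZl S theta K zeta.
  have mulAZr := @sqf_algebra_mulZr S theta K zeta.
  have mulTBl := tensor_mulBl mulABl mulABr mulAZl mulAZr.
  have mulTBr := tensor_mulBr mulABl mulABr mulAZl mulAZr.
  move: y; apply: (malg_morph_ext (zmod_morph_comp to_tensorB (mulDBr x))
    (zmod_morph_comp (mulTBr (to_tensor x)) to_tensorB)) => d t /=.
  move: x; apply: (malg_morph_ext (zmod_morph_comp to_tensorB (mulDBl _))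
    (zmod_morph_comp (mulTBl _) to_tensorB)) => c s /=.
  rewrite !to_tensorU (tensor_mul_tens mulABl mulABr mulAZl mulAZr).
  have -> : mulD << c *g s >> << d *g t >> = _ :=
    twisted_mulUU (fun=> idfun) (fun s t => val (zeta s t)) s t c d.
  have -> : sqf_algebra_mul zeta << s >> << t >> = _ :=
    twisted_mulUU (fun=> idfun) zeta s t 1 1.
  case: insub => [u|]; last first.
    by rewrite (zmod_morph0 to_tensorB) (zmod_morph0 (tensZmod_r _)).
  rewrite to_tensorU tensZ !mul1r; congr tens.
  by apply/malgP=> v; rewrite mcoeffZ !mcoeffU mulrnAr mulr1.
Qed.

End TensorAlgebra.

(** * Division rings and their automorphisms *)

Section DivisionRingTheory.
Variable D : divisionRingType.
Implicit Types x y : D.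

Lemma mul_divisionV x : x != 0 -> x * x^-1 = 1.
Proof. by move=> x0; rewrite divrr // division_ringP. Qed.

Lemma division_mulI x : x != 0 -> injective ( *%R x).
Proof. by move=> /division_ringP xU; apply: mulrI. Qed.

Lemma division_mulIr x : x != 0 -> injective ( *%R^~ x).
Proof. by move=> /division_ringP xU; apply: mulIr. Qed.

Lemma division_mul_neq0 x y : x != 0 -> y != 0 -> x * y != 0.
Proof.
move=> x0; apply: contra_neq => xy0; apply: (division_mulI x0).
by rewrite xy0 mulr0.
Qed.

Lemma division_inv_neq0 x : x != 0 -> x^-1 != 0.
Proof. by rewrite invr_eq0. Qed.

Lemma ring_aut_inj (f : ring_aut D) : injective f.
Proof. exact: can_inj (@aut_funK _ f). Qed.

Lemma ring_aut_neq0 (f : ring_aut D) x : x != 0 -> f x != 0.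
Proof.
by apply: contra_neq => fx0; apply: (@ring_aut_inj f); rewrite fx0 rmorph0.
Qed.

End DivisionRingTheory.

Section RingAutInverse.
Variables (D : nzRingType) (f : ring_aut D).

Let invB : zmod_morphism (aut_inv f) :=
  can2_zmod_morphism (@aut_funK _ f) (@aut_invK _ f).
Let invM : monoid_morphism (aut_inv f) :=
  can2_monoid_morphism (@aut_funK _ f) (@aut_invK _ f).

HB.instance Definition _ := GRing.isZmodMorphism.Build D D (aut_inv f) invB.
HB.instance Definition _ := GRing.isMonoidMorphism.Build D D (aut_inv f) invM.

Definition ring_aut_inv : ring_aut D :=
  @RingAut D (aut_inv f) f (@aut_invK _ f) (@aut_funK _ f).

End RingAutInverse.

Lemma ring_aut_exists (D : nzRingType) (f g : D -> D) :
    zmod_morphism f -> monoid_morphism f -> cancel f g -> cancel g f ->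
  exists r : ring_aut D, r =1 f.
Proof.
move=> fB fM fK gK.
pose fB' := GRing.isZmodMorphism.Build D D f fB.
pose fM' := GRing.isMonoidMorphism.Build D D f fM.
by exists (@RingAut D (HB.pack f fB' fM' : {rmorphism D -> D}) g fK gK).
Qed.

(** * Corners of a square-free semigroup *)

Section SemigroupCorners.
Local Open Scope group_scope.
Variables (S : semigroupType) (theta : S) (E : {pred S}).
Hypothesis hS : square_free_semigroup theta E.
Implicit Types i j k l s t : S.

Let mul0s s : theta * s = theta. Proof. exact: (sqf_mul0s hS). Qed.
Let muls0 s : s * theta = theta. Proof. exact: (sqf_muls0 hS). Qed.

Lemma mul_neq0_l s t : s * t != theta -> s != theta.
Proof. by apply: contra_neq => ->. Qed.

Lemma mul_neq0_r s t : s * t != theta -> t != theta.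
Proof. by apply: contra_neq => ->. Qed.

Lemma cornerP i j s : i \in E -> j \in E ->
  corner i j s <-> i * s = s /\ s * j = s.
Proof.
move=> iE jE; split=> [[x ->]|[is_ sj]]; last by exists s; rewrite is_ sj.
by rewrite !mulgA (sqf_idem hS) // -!mulgA (sqf_idem hS).
Qed.

Lemma corner_idem i : i \in E -> corner i i i.
Proof. by move=> iE; exists i; rewrite !(sqf_idem hS). Qed.

Lemma corner_theta i j : corner i j theta.
Proof. by exists theta; rewrite muls0 mul0s. Qed.

Lemma cornerM i j k s t : corner i j s -> corner j k t -> corner i k (s * t).
Proof. by move=> [x ->] [y ->]; exists (x * j * (j * y)); rewrite !mulgA. Qed.

Lemma corner_matchl i j k s : i \in E -> k \in E -> corner i j s ->
  k * s != theta -> k = i.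
Proof.
move=> iE kE [x ->]; rewrite !mulgA; apply: contraNeq => ki.
by rewrite (sqf_orth hS kE iE ki) !mul0s.
Qed.

Lemma corner_matchr i j k s : j \in E -> k \in E -> corner i j s ->
  s * k != theta -> k = j.
Proof.
move=> jE kE [x ->]; rewrite -!mulgA; apply: contraNeq; rewrite eq_sym => ki.
by rewrite (sqf_orth hS jE kE ki) !muls0.
Qed.

Lemma corner_uniq i i' j j' s : i \in E -> i' \in E -> j \in E -> j' \in E ->
  corner i j s -> corner i' j' s -> s != theta -> i = i' /\ j = j'.
Proof.
move=> iE i'E jE j'E sij /cornerP-[] // i's sj' s0; split; apply: esym.
  by apply: (corner_matchl iE i'E sij); rewrite i's.
by apply: (corner_matchr jE j'E sij); rewrite sj'.
Qed.

Lemma corner_match i j j' k s t : j \in E -> j' \in E ->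
  corner i j s -> corner j' k t -> s * t != theta -> j = j'.
Proof.
move=> jE j'E [x ->] [y ->]; rewrite !mulgA; apply: contraNeq => jj'.
by rewrite -[_ * j * j']mulgA (sqf_orth hS jE j'E jj') muls0 !mul0s.
Qed.

Lemma corner_ends : exists lr : S -> S * S,
  forall s, [/\ (lr s).1 \in E, (lr s).2 \in E & corner (lr s).1 (lr s).2 s].
Proof.
have /choice[lr lrP] : forall s, exists p : S * S,
    [/\ p.1 \in E, p.2 \in E & corner p.1 p.2 s].
  by move=> s; have [i [j ijs]] := sqf_cover hS s; exists (i, j).
by exists lr.
Qed.

End SemigroupCorners.

(** * Monomials *)

(** Monomials are indexed by all of S, with value 0 at theta, so that products
    of monomials need no case analysis.  The definition is locked because
    comparing two distinct monomials by conversion would unfold finitely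
    supported functions. *)
HB.lock Definition mon (S : semigroupType) (theta : S) (D : divisionRingType)
    (c : D) (s : S) : {malg D[nonzero theta]} :=
  if insub s is Some u then << c *g u >> else 0.
Arguments mon {S theta D} c s.

Section Monomials.
Variables (S : semigroupType) (theta : S) (D : divisionRingType).
Local Notation DS := {malg D[nonzero theta]}.
Local Notation mon := (@mon S theta D).
Implicit Types (c d : D) (s t : S) (x y z : DS).

Lemma monE c (u : nonzero theta) : mon c (val u) = << c *g u >>.
Proof. by rewrite mon.unlock valK. Qed.

Lemma mon_theta c : mon c theta = 0.
Proof. by rewrite mon.unlock insubF // eqxx. Qed.

Lemma monB s : zmod_morphism (mon^~ s).
Proof.
move=> c d; rewrite mon.unlock.
by case: insub => [u|]; rewrite ?monalgUB ?subr0.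
Qed.

Lemma mon0 s : mon 0 s = 0. Proof. exact: zmod_morph0 (@monB s). Qed.

Lemma monD c d s : mon (c + d) s = mon c s + mon d s.
Proof. exact: zmod_morphD (@monB s) c d. Qed.

Lemma mon_neq0 c s : mon c s != 0 -> c != 0 /\ s != theta.
Proof.
by move=> m0; split; apply: contraNneq m0 => ->; rewrite ?mon0 ?mon_theta.
Qed.

Lemma mon_inj c d s t : s != theta -> c != 0 -> mon c s = mon d t ->
  c = d /\ s = t.
Proof.
move=> s0 c0; pose u : nonzero theta := exist _ s s0; rewrite -[s]/(val u) monE.
have [->|t0] := eqVneq t theta.
  by rewrite mon_theta => /eqP; rewrite monalgU_eq0 (negPf c0).
pose v : nonzero theta := exist _ t t0; rewrite -[t]/(val v) monE.
move=> /(congr1 (mcoeff u)); rewrite mcoeffUU mcoeffU.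
by case: eqP => [->|_] // c00; rewrite c00 eqxx in c0.
Qed.

Lemma mon_injl c d s : s != theta -> mon c s = mon d s -> c = d.
Proof.
move=> s0 cd; apply/eqP; rewrite -subr_eq0; apply/negPn/negP => cd0.
have /(mon_inj s0 cd0)[e0 _] : mon (c - d) s = mon 0 s.
  by rewrite (@monB s) cd subrr mon0.
by rewrite e0 eqxx in cd0.
Qed.

Lemma mon_ind (P : DS -> Prop) :
    P 0 -> (forall x y, P x -> P y -> P (x + y)) ->
  (forall c s, s != theta -> P (mon c s)) -> forall x, P x.
Proof.
move=> P0 PD Pm; elim/malg_ind=> // c u; rewrite -monE; apply: Pm.
exact: (valP u).
Qed.

Lemma mon_ext (V : zmodType) (f g : DS -> V) :
    zmod_morphism f -> zmod_morphism g ->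
  (forall c s, s != theta -> f (mon c s) = g (mon c s)) -> f =1 g.
Proof.
move=> fB gB fg; apply: malg_morph_ext => // c u.
by rewrite -monE fg // (valP u).
Qed.

End Monomials.

(** * The twisted semigroup ring of a cocycle *)

(** A locked copy of the multiplication: conversion must not unfold products to
    sums over supports. *)
HB.lock Definition tmul (S : semigroupType) (theta : S) (D : divisionRingType)
    (alpha : S -> ring_aut D) (xi : S -> S -> D) :
    {malg D[nonzero theta]} -> {malg D[nonzero theta]} ->
    {malg D[nonzero theta]} :=
  sqf_ring_mul alpha xi.
Arguments tmul {S theta D} alpha xi x y.

Section TwistedRing.
Variables (S : semigroupType) (theta : S) (E : {pred S}).
Hypothesis hS : square_free_semigroup theta E.
Variables (D : divisionRingType) (alpha : S -> ring_aut D) (xi : S -> S -> D).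
Hypothesis hc : cocycle2 theta alpha xi.
Local Notation DS := {malg D[nonzero theta]}.
Local Notation mon := (@mon S theta D).
Local Notation mul := (@tmul S theta D alpha xi).
Implicit Types (c d : D) (i j k s t : S) (x y z : DS).

Lemma tmulE : mul = @sqf_ring_mul S theta D alpha xi.
Proof. by rewrite tmul.unlock. Qed.

Lemma tmulBl y : zmod_morphism (mul^~ y).
Proof.
rewrite tmul.unlock.
exact: (twisted_mulBl (fun s => alpha s : {additive D -> D})).
Qed.

Lemma tmulBr x : zmod_morphism (mul x).
Proof.
rewrite tmul.unlock.
exact: (twisted_mulBr (fun s => alpha s : {additive D -> D})).
Qed.

Lemma tmulDl x y z : mul (x + y) z = mul x z + mul y z.
Proof. exact: zmod_morphD (@tmulBl z) x y. Qed.

Lemma tmulDr x y z : mul x (y + z) = mul x y + mul x z.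
Proof. exact: zmod_morphD (@tmulBr x) y z. Qed.

Lemma tmul0x x : mul 0 x = 0. Proof. exact: zmod_morph0 (@tmulBl x). Qed.
Lemma tmulx0 x : mul x 0 = 0. Proof. exact: zmod_morph0 (@tmulBr x). Qed.

Lemma tmul_mon c d s t :
  mul (mon c s) (mon d t) = mon (c * alpha s d * xi s t) (s * t)%g.
Proof.
have [->|s0] := eqVneq s theta.
  by rewrite (sqf_mul0s hS) !mon_theta tmul0x.
have [->|t0] := eqVneq t theta.
  by rewrite (sqf_muls0 hS) !mon_theta tmulx0.
pose u : nonzero theta := exist _ s s0; rewrite -[s]/(val u) monE.
pose v : nonzero theta := exist _ t t0; rewrite -[t]/(val v) monE.
rewrite mon.unlock tmul.unlock.
exact: (twisted_mulUU (fun s => alpha s : {additive D -> D}) xi u v c d).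
Qed.

(** On monomials with nonzero product, associativity is the conjunction of the
    two cocycle conditions. *)
Lemma tmulA x y z : mul x (mul y z) = mul (mul x y) z.
Proof.
move: x; apply: (mon_ext (tmulBl _) (zmod_morph_comp (tmulBl z) (tmulBl y))).
move=> b s _ /=; move: y.
apply: (mon_ext (zmod_morph_comp (tmulBr _) (tmulBl z))
  (zmod_morph_comp (tmulBl z) (tmulBr _))) => c t _ /=; move: z.
apply: (mon_ext (zmod_morph_comp (tmulBr _) (tmulBr _)) (tmulBr _)) => d u _ /=.
rewrite !tmul_mon mulgA.
have [->|stu0] := eqVneq (s * t * u)%g theta; first by rewrite !mon_theta.
congr mon.
have st0 : (s * t)%g != theta := mul_neq0_l hS stu0.
have := cocycle2_aut hc stu0 d; rewrite /inner /= => stE.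
rewrite !rmorphM /= stE -!mulrA; congr (_ * (_ * _)).
rewrite (cocycle2_mul hc stu0) mulKr //.
exact/division_ringP/(cocycle2_neq0 hc).
Qed.

Section Idempotents.
Variable (i : S).
Hypothesis iE : i \in E.

Let i0 : i != theta. Proof. exact: (sqf_neq0 hS). Qed.
Let ii : (i * i)%g = i. Proof. exact: (sqf_idem hS). Qed.

Lemma xi_idem_neq0 : xi i i != 0.
Proof. by apply: (cocycle2_neq0 hc); rewrite ii. Qed.

(** The second cocycle condition at (i, i, i) reads
    alpha_i o alpha_i = tau o alpha_i, and alpha_i is onto. *)
Lemma alpha_idem d : alpha i d = inner (xi i i) d.
Proof.
have iii0 : (i * i * i)%g != theta by rewrite !ii.
have := cocycle2_aut hc iii0 (aut_inv (alpha i) d).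
by rewrite /= ii aut_invK.
Qed.

(** The first cocycle condition at (i, i, s), after cancelling xi i s, reads
    alpha_i (xi i s) = xi i i, and alpha_i is conjugation by xi i i. *)
Lemma xi_idem_l s : s != theta -> (i * s)%g = s -> xi i s = xi i i.
Proof.
move=> s0 is_; have iis0 : (i * i * s)%g != theta by rewrite ii is_.
have := cocycle2_mul hc iis0; rewrite is_ ii => xE.
have xis0 : xi i s != 0 by apply: (cocycle2_neq0 hc); rewrite is_.
have := division_mulIr xis0 xE; rewrite alpha_idem /inner => conjE.
have xii0 := xi_idem_neq0.
apply: (division_mulI xii0); apply: (division_mulIr (division_inv_neq0 xii0)).
by rewrite conjE -mulrA mul_divisionV ?mulr1.
Qed.

(** The first cocycle condition at (s, i, i), after cancelling xi s i. *)
Lemma xi_idem_r s : s != theta -> (s * i)%g = s -> xi s i = alpha s (xi i i).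
Proof.
move=> s0 si; have sii0 : (s * i * i)%g != theta by rewrite !si.
have := cocycle2_mul hc sii0; rewrite si ii => xE.
have xsi0 : xi s i != 0 by apply: (cocycle2_neq0 hc); rewrite si.
by rewrite (division_mulIr xsi0 xE).
Qed.

(** The cocycle is not normalized: the identity of the corner of i is
    (xi i i)^-1 i, and cscal c is c times that identity. *)
Definition cscal c : DS := mon (c / xi i i) i.

Lemma cscal_neq0 c : c != 0 -> cscal c != 0.
Proof.
move=> c0; apply/eqP; rewrite -(mon0 theta D i) => /(mon_injl i0)/eqP.
by apply/negP/division_mul_neq0/division_inv_neq0/xi_idem_neq0.
Qed.

Lemma mul_cscal_mon c d s : (i * s)%g = s ->
  mul (cscal c) (mon d s) = mon (c * d) s.
Proof.
move=> is_; have [->|s0] := eqVneq s theta; first by rewrite !mon_theta tmulx0.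
rewrite tmul_mon is_ xi_idem_l // alpha_idem /inner; congr mon.
have xU := division_ringP _ xi_idem_neq0.
by rewrite !mulrA !divrK.
Qed.

Lemma mul_cscal_mon0 c d s : (i * s)%g = theta -> mul (cscal c) (mon d s) = 0.
Proof. by move=> is0; rewrite tmul_mon is0 mon_theta. Qed.

Lemma mul_mon_cscal c d s : (s * i)%g = s ->
  mul (mon c s) (cscal d) = mon (c * alpha s d) s.
Proof.
move=> si; have [->|s0] := eqVneq s theta; first by rewrite !mon_theta tmul0x.
have xU := division_ringP _ xi_idem_neq0.
by rewrite tmul_mon si (xi_idem_r s0 si) -mulrA -rmorphM divrK.
Qed.

Lemma mul_mon_cscal0 c d s : (s * i)%g = theta -> mul (mon c s) (cscal d) = 0.
Proof. by move=> si0; rewrite tmul_mon si0 mon_theta. Qed.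

Lemma cscalM c d : mul (cscal c) (cscal d) = cscal (c * d).
Proof. by rewrite {2}/cscal mul_cscal_mon // mulrA. Qed.

Lemma cscal_inj : injective cscal.
Proof.
move=> c d /(mon_injl i0); apply: division_mulIr.
exact/division_inv_neq0/xi_idem_neq0.
Qed.

End Idempotents.

(** Square-freeness: each corner has dimension at most 1 over D.  The zero
    element is included as the case s = theta. *)
Lemma corner_mon i j x : i \in E -> j \in E ->
  exists c s, corner i j s /\ mul (mul (cscal i 1) x) (cscal j 1) = mon c s.
Proof.
move=> iE jE; elim/(@mon_ind S theta D): x => [|x y|c s s0].
- exists 0, theta; split; first exact: (corner_theta hS).
  by rewrite tmulx0 tmul0x mon_theta.
- move=> [c [s [sij xE]]] [d [t [tij yE]]].
  rewrite tmulDr tmulDl xE yE.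
  have [->|s0] := eqVneq s theta; first by exists d, t; rewrite mon_theta add0r.
  have [->|t0] := eqVneq t theta; first by exists c, s; rewrite mon_theta addr0.
  by exists (c + d), s; rewrite monD (sqf_le1 hS iE jE tij sij).
have [is0|is0] := eqVneq (i * s)%g theta.
  exists 0, theta; split; first exact: (corner_theta hS).
  by rewrite mul_cscal_mon0 // tmul0x mon_theta.
have [sj0|sj0] := eqVneq (s * j)%g theta.
  exists 0, theta; split; first exact: (corner_theta hS).
  by rewrite -tmulA mul_mon_cscal0 // tmulx0 mon_theta.
have [k [l [kE lE skl]]] := sqf_cover hS s.
have ik := corner_matchl hS kE iE skl is0.
have jl := corner_matchr hS lE jE skl sj0.
rewrite ik jl in iE jE *.
have [ks sl] := (cornerP hS s kE lE).1 skl.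
by exists c, s; rewrite mul_cscal_mon // mul_mon_cscal // mul1r rmorph1 mulr1.
Qed.

Lemma corner_cscal i x : i \in E ->
  exists c, mul (mul (cscal i 1) x) (cscal i 1) = cscal i c.
Proof.
move=> iE; have [c [s [sii ->]]] := corner_mon x iE iE.
have [->|s0] := eqVneq s theta.
  by exists 0; rewrite mon_theta /cscal mul0r mon0.
exists (c * xi i i); rewrite (sqf_le1 hS iE iE sii (corner_idem hS iE)) //.
  by rewrite /cscal mulrK //; apply/division_ringP/xi_idem_neq0.
exact: (sqf_neq0 hS).
Qed.

(** The ring has enough idempotents.  The conclusion is claimed for all larger
    lists of idempotents, so that lists for two summands can be merged. *)
Lemma local_unit x : exists2 L : seq S, {subset L <= E} &
  forall L' : seq S, uniq L' -> {subset L <= L'} -> {subset L' <= E} ->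
    \sum_(k <- L') mul (cscal k 1) x = x.
Proof.
elim/(@mon_ind S theta D): x => [|x y|c s s0].
- by exists [::] => // L' _ _ _; rewrite big1 // => k _; rewrite tmulx0.
- move=> [L LE xE] [M ME yE]; exists (L ++ M) => [k|L' uL' LL' L'E].
    by rewrite mem_cat => /orP[/LE|/ME].
  under eq_bigr do rewrite tmulDr.
  rewrite big_split /= xE ?yE // => k kL; apply: LL'; rewrite mem_cat kL //.
  by rewrite orbT.
have [i [j [iE jE sij]]] := sqf_cover hS s.
have [is_ _] := (cornerP hS s iE jE).1 sij.
exists [:: i] => [k|L' uL' LL' L'E]; first by rewrite inE => /eqP->.
have iL' : i \in L' by apply: LL'; rewrite inE.
rewrite (bigD1_seq i) //= mul_cscal_mon // mul1r big_seq_cond big1 ?addr0 //.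
move=> k /andP[/L'E kE ki]; apply: mul_cscal_mon0; apply/eqP/negPn/negP => ks0.
by rewrite (corner_matchl hS iE kE sij ks0) eqxx in ki.
Qed.

Lemma local_idem x y : mul y x != 0 ->
  exists2 k, k \in E & mul y (mul (cscal k 1) x) != 0.
Proof.
move=> yx0; have [L LE LP] := local_unit x.
have := LP (undup L) (undup_uniq L); set M := undup L => ME.
have {ME}xE : \sum_(k <- M) mul (cscal k 1) x = x.
  by apply: ME => k; rewrite mem_undup //; apply: LE.
apply: contrapT => noK; case/eqP: yx0.
rewrite -xE (zmod_morph_sum (tmulBr y)) big_seq big1 // => k kM.
apply/eqP/negPn/negP => k0; apply: noK; exists k => //.
by apply: LE; rewrite -mem_undup.
Qed.

End TwistedRing.

(** * Cohomologous cocycles and isomorphisms given by rescaling *)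

Section Cohomology.
Variables (S : semigroupType) (theta : S) (E : {pred S}).
Hypothesis hS : square_free_semigroup theta E.
Variable D : divisionRingType.
Variables (alpha beta : S -> ring_aut D) (xi zeta : S -> S -> D).

(** The equations for c s |-> nu_i(c) h_s s, with s in e_i S e_j, to be
    multiplicative from D^alpha_xi S to D^beta_zeta S. *)
Definition intertwining (nu : S -> ring_aut D) (h : S -> D) : Prop :=
  [/\ forall s, s != theta -> h s != 0,
      forall i j s d, i \in E -> j \in E -> corner i j s -> s != theta ->
        nu i (alpha s d) * h s = h s * beta s (nu j d)
    & forall i j k s t, i \in E -> j \in E -> k \in E ->
        corner i j s -> corner j k t -> (s * t)%g != theta ->
        nu i (xi s t) * h (s * t)%g = h s * beta s (h t) * zeta s t].

(** The substitution is nu_i = mu_i^-1 and h_s = nu_i (eta s)^-1; the source i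
    of s is read off from s, since a nonzero s lies in only one corner. *)
Lemma cohomologous_intertwining :
  cohomologous theta E alpha xi beta zeta -> exists nu h, intertwining nu h.
Proof.
move=> [mu [eta [eta0 betaE zetaE]]]; have [lr lrP] := corner_ends hS.
pose nu i := ring_aut_inv (mu i); pose h s := (nu (lr s).1 (eta s))^-1.
have hE i j s : i \in E -> j \in E -> corner i j s -> s != theta ->
    h s = (nu i (eta s))^-1.
  move=> iE jE sij s0; have [lE rE slr] := lrP s.
  by have [<-] := corner_uniq hS lE iE rE jE slr sij s0.
have nu_eta i s : s != theta -> nu i (eta s) \is a GRing.unit.
  by move=> s0; apply/division_ringP/ring_aut_neq0/eta0.
have nuP i j s d : i \in E -> j \in E -> corner i j s -> s != theta ->
    nu i (alpha s d) * h s = h s * beta s (nu j d).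
  move=> iE jE sij s0; rewrite (hE i j s) // (betaE i j s) //= /inner.
  have etaU : eta s \is a GRing.unit by apply/division_ringP/eta0.
  rewrite aut_invK !(rmorphM (nu i)) (rmorphV (nu i)) // -!mulrA mulKr //.
  exact: nu_eta.
exists nu, h; split=> // [s s0|i j k s t iE jE kE sij tjk st0].
  by apply/division_inv_neq0/ring_aut_neq0/eta0.
have s0 := mul_neq0_l hS st0; have t0 := mul_neq0_r hS st0.
have etU : eta (s * t)%g \is a GRing.unit by apply/division_ringP/eta0.
rewrite (hE i k (s * t)%g) //; last exact: cornerM sij tjk.
rewrite (zetaE i j k) // -/(nu i (_ / _)) !(rmorphM (nu i)) (rmorphV (nu i)) //.
rewrite (hE j k t) // rmorphV ?nu_eta //.
have aU := nu_eta i s s0; have yU : beta s (nu j (eta t)) \is a GRing.unit.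
  by rewrite rmorph_unit // nu_eta.
have := nuP i j s (eta t) iE jE sij s0; rewrite (hE i j s) //.
move/(congr1 (fun z => nu i (eta s) * z * nu i (eta s))).
(* With A = nu_i(eta s), B = nu_i(alpha_s(eta t)) and Y = beta_s(nu_j(eta t)),
   the intertwining equation becomes A B = Y A. *)
rewrite mulrA mulVKr // mulrVK // => abE.
by rewrite abE -!mulrA mulKr // mulKr.
Qed.

Lemma intertwining_cohomologous nu h :
  intertwining nu h -> cohomologous theta E alpha xi beta zeta.
Proof.
move=> [h0 nuP hP]; have [lr lrP] := corner_ends hS.
pose mu i := ring_aut_inv (nu i); pose eta s := mu (lr s).1 (h s)^-1.
have etaE i j s : i \in E -> j \in E -> corner i j s -> s != theta ->
    nu i (eta s) = (h s)^-1.
  move=> iE jE sij s0; have [lE rE slr] := lrP s.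
  have [<- _] := corner_uniq hS lE iE rE jE slr sij s0.
  by rewrite /eta /= aut_invK.
have hU s : s != theta -> h s \is a GRing.unit by move/h0/division_ringP.
have eta0 s : s != theta -> eta s != 0.
  by move=> s0; apply/ring_aut_neq0/division_inv_neq0/h0.
exists mu, eta; split=> // [i j s iE jE sij s0 d|].
  rewrite /= /inner !(rmorphM (nu i)) (rmorphV (nu i)); last first.
    exact/division_ringP/eta0.
  rewrite (etaE i j) // invrK -mulrA (nuP i j) //= mulKr ?hU //.
  by rewrite aut_invK.
move=> i j k s t iE jE kE sij tjk st0.
have s0 := mul_neq0_l hS st0; have t0 := mul_neq0_r hS st0.
rewrite /= !(rmorphM (nu i)) (rmorphV (nu i)); last first.
  exact/division_ringP/eta0.
rewrite (etaE i j s) // (etaE i k (s * t)%g) ?invrK //; last first.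
  exact: cornerM sij tjk.
rewrite -mulrA (hP i j k) // -!mulrA.
have := nuP i j s (eta t) iE jE sij s0; rewrite (etaE j k t) // rmorphV ?hU //.
move/(congr1 (fun z => z * beta s (h t))).
rewrite mulrVK; last by rewrite rmorph_unit // hU.
rewrite -mulrA => abE; rewrite (mulrA (h s)) (mulrA (nu i _)).
by rewrite abE mulKr ?hU.
Qed.

Lemma intertwining_iso nu h : intertwining nu h ->
  rng_isomorphic (@tmul S theta D alpha xi) (@tmul S theta D beta zeta).
Proof.
move=> [h0 nuP hP]; have [lr lrP] := corner_ends hS.
have hU s : s != theta -> h s \is a GRing.unit by move/h0/division_ringP.
pose n s := nu (lr s).1.
pose f := linear_ext (fun (u : nonzero theta) c =>
  mon (n (val u) c * h (val u)) (val u) : {malg D[nonzero theta]}).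
pose g := linear_ext (fun (u : nonzero theta) c =>
  mon (aut_inv (n (val u)) (c / h (val u))) (val u) : {malg D[nonzero theta]}).
have fB : zmod_morphism f.
  by apply: linear_extB => u c d; rewrite raddfB mulrBl (@monB S theta D).
have gB : zmod_morphism g.
  by apply: linear_extB => u c d; rewrite mulrBl raddfB (@monB S theta D).
have fE c s : s != theta -> f (mon c s) = mon (n s c * h s) s.
  move=> s0; pose u : nonzero theta := exist _ s s0; rewrite -[s]/(val u) monE.
  rewrite /f linear_extU // => {}u {}c d.
  by rewrite raddfB mulrBl (@monB S theta D).
have gE c s : s != theta -> g (mon c s) = mon (aut_inv (n s) (c / h s)) s.
  move=> s0; pose u : nonzero theta := exist _ s s0; rewrite -[s]/(val u) monE.
  rewrite /g linear_extU // => {}u {}c d.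
  by rewrite mulrBl raddfB (@monB S theta D).
apply: (rng_isomorphic_intro (g := g) fB).
- apply: (@mon_ext _ _ _ _ _ idfun (zmod_morph_comp gB fB)) => // c s s0 /=.
  by rewrite fE // gE // mulrK ?hU // aut_funK.
- apply: (@mon_ext _ _ _ _ _ idfun (zmod_morph_comp fB gB)) => // c s s0 /=.
  by rewrite gE // fE // aut_invK divrK ?hU.
move=> x y; move: x.
apply: (mon_ext (zmod_morph_comp fB (tmulBl _ _ y))
  (zmod_morph_comp (tmulBl _ _ _) fB)) => c s s0 /=; move: y.
apply: (mon_ext (zmod_morph_comp fB (tmulBr _ _ _))
  (zmod_morph_comp (tmulBr _ _ _) fB)) => d t t0 /=.
rewrite (tmul_mon hS) (fE c s s0) (fE d t t0) (tmul_mon hS).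
have [->|st0] := eqVneq (s * t)%g theta.
  by rewrite !mon_theta (zmod_morph0 fB).
rewrite fE //; congr mon.
have [lE rE slr] := lrP s; have [lE' rE' tlr] := lrP t.
have rl := corner_match hS rE lE' slr tlr st0.
have [lE'' rE'' stlr] := lrP (s * t)%g.
rewrite -rl in tlr.
have [lst _] := corner_uniq hS lE'' lE rE'' rE' stlr (cornerM slr tlr) st0.
rewrite /n lst -rl !(rmorphM (nu _)) rmorphM -!mulrA; congr (_ * _).
rewrite (hP _ _ _ _ _ lE rE rE' slr tlr st0) !mulrA.
by rewrite (nuP (lr s).1 (lr s).2 s d).
Qed.

End Cohomology.

(** * Transport of corners along an isomorphism *)

Section Isomorphism.
Variables (S : semigroupType) (theta : S) (E : {pred S}).
Hypothesis hS : square_free_semigroup theta E.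
Variable D : divisionRingType.
Variables (alpha beta : S -> ring_aut D) (xi zeta : S -> S -> D).
Hypothesis hc : cocycle2 theta alpha xi.
Hypothesis hc' : cocycle2 theta beta zeta.

Local Notation DS := {malg D[nonzero theta]}.
Local Notation mon := (@mon S theta D).
Local Notation mul := (@tmul S theta D alpha xi).
Local Notation mul' := (@tmul S theta D beta zeta).
Local Notation scal := (@cscal S theta D xi).
Local Notation scal' := (@cscal S theta D zeta).

Variables phi psi : DS -> DS.
Hypothesis phiB : zmod_morphism phi.
Hypothesis phiK : cancel phi psi.
Hypothesis psiK : cancel psi phi.
Hypothesis phiM : {morph phi : x y / mul x y >-> mul' x y}.

Let phi_inj : injective phi. Proof. exact: can_inj phiK. Qed.

Let phi_neq0 x : x != 0 -> phi x != 0.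
Proof.
by apply: contra_neq => x0; apply: phi_inj; rewrite x0 (zmod_morph0 phiB).
Qed.

Let tmulA' := tmulA hS hc'.

(** u and v realize an isomorphism between the modules R' f and R' e, where f is
    the image of the identity of corner i and e is the identity of corner k. *)
Record corner_transfer (i k : S) (u v : DS) : Prop := CornerTransfer {
  transferE : k \in E;
  transfer_uv : mul' u v = phi (scal i 1);
  transfer_vu : mul' v u = scal' k 1;
  transfer_u : mul' u (scal' k 1) = u;
  transfer_v : mul' (scal' k 1) v = v }.

(** The corner of f = phi(eps_i) is a division ring and some f e_k f is nonzero.
    If w is the inverse of f e_k f there, then u = f e_k and v = e_k w satisfy
    u v = f, so v u is a nonzero idempotent of the corner of k.  That corner is
    a copy of D, whose only nonzero idempotent is 1. *)
Lemma corner_transfer_exists i : i \in E ->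
  exists k u v, corner_transfer i k u v.
Proof.
move=> iE; set f := phi (scal i 1).
have ff : mul' f f = f by rewrite -phiM (cscalM hS hc) // mulr1.
have f0 : f != 0 by apply/phi_neq0/(cscal_neq0 hS hc)/oner_neq0.
have [|k kE fkf0] := @local_idem _ _ _ hS _ _ _ hc' f f; first by rewrite ff.
set e := scal' k 1 in fkf0.
have ee : mul' e e = e by rewrite (cscalM hS hc') // mulr1.
set z := mul' f (mul' e f) in fkf0.
have [c zE] : exists c, z = phi (scal i c).
  have [c cE] := corner_cscal hS hc (psi z) iE; exists c.
  by rewrite -cE !phiM psiK -/f /z !tmulA' ff -!tmulA' ff.
have c0 : c != 0.
  apply: contraNneq fkf0 => c0; rewrite zE c0 /cscal mul0r mon0.
  by rewrite (zmod_morph0 phiB).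
set w := phi (scal i c^-1).
have zw : mul' z w = f by rewrite zE -phiM (cscalM hS hc) // mul_divisionV.
have fw : mul' f w = w by rewrite -phiM (cscalM hS hc) // mul1r.
have wf : mul' w f = w by rewrite -phiM (cscalM hS hc) // mulr1.
pose u := mul' f e; pose v := mul' e w.
have ue : mul' u e = u by rewrite /u -tmulA' ee.
have ev : mul' e v = v by rewrite /v tmulA' ee.
have uv : mul' u v = f.
  by rewrite -[RHS]zw /u /v /z -!tmulA' fw [mul' e (mul' e w)]tmulA' ee.
have fu : mul' f u = u by rewrite /u tmulA' ff.
have [d dE] := corner_cscal hS hc' w kE.
have vuE : mul' v u = scal' k d.
  by rewrite -dE /u /v !tmulA' -[mul' (mul' e w) f]tmulA' wf.
have dd : d * d = d.
  apply: (cscal_inj hS hc' kE); rewrite -(cscalM hS hc') // -vuE.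
  by rewrite tmulA' -[mul' (mul' v u) v]tmulA' uv -tmulA' fu.
have d0 : d != 0.
  apply: contraNneq f0 => d0.
  rewrite -ff -uv tmulA' -[mul' (mul' u v) u]tmulA' vuE.
  by rewrite d0 /cscal mul0r mon0 tmulx0 tmul0x.
exists k, u, v; split=> //; rewrite vuE; congr scal'.
by apply: (division_mulI d0); rewrite dd mulr1.
Qed.

Section Transfer.
Variables (i k : S) (u v : DS).
Hypothesis iE : i \in E.
Hypothesis tr : corner_transfer i k u v.

Let uv := transfer_uv tr.
Let vu := transfer_vu tr.
Let ue := transfer_u tr.
Let ev := transfer_v tr.
Let kE := transferE tr.

Lemma transfer_fu : mul' (phi (scal i 1)) u = u.
Proof. by rewrite -uv -tmulA' vu. Qed.

Lemma transfer_vf : mul' v (phi (scal i 1)) = v.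
Proof. by rewrite -uv tmulA' vu. Qed.

(** Both corners are copies of D, and x |-> psi(u x v) is inverse to
    x |-> v phi(x) u. *)
Lemma transfer_aut : exists nu : ring_aut D,
  forall c, mul' (mul' v (phi (scal i c))) u = scal' k (nu c).
Proof.
have /choice[n nE] : forall c, exists d,
    mul' (mul' v (phi (scal i c))) u = scal' k d.
  move=> c.
  have [d dE] := corner_cscal hS hc' (mul' (mul' v (phi (scal i c))) u) kE.
  by exists d; rewrite -dE !tmulA' ev -[RHS]tmulA' ue.
have /choice[m mE] : forall d, exists c,
    psi (mul' (mul' u (scal' k d)) v) = scal i c.
  move=> d.
  have [c cE] := corner_cscal hS hc (psi (mul' (mul' u (scal' k d)) v)) iE.
  exists c; rewrite -cE; apply: phi_inj.
  by rewrite !phiM !psiK !tmulA' transfer_fu -[RHS]tmulA' transfer_vf.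
have nB : zmod_morphism n.
  move=> c d; apply: (cscal_inj hS hc' kE); rewrite -nE.
  have scB (z : S -> S -> D) j : zmod_morphism (@cscal S theta D z j).
    by move=> a b; rewrite /cscal mulrBl (@monB S theta D).
  by rewrite !scB phiB tmulBr tmulBl !nE.
have nM : monoid_morphism n.
  split=> [|c d]; apply: (cscal_inj hS hc' kE); rewrite -nE.
    by rewrite transfer_vf vu.
  rewrite -(cscalM hS hc') // -!nE -(cscalM hS hc) // phiM.
  rewrite !tmulA' -[mul' (mul' (mul' v _) u) v]tmulA' uv.
  rewrite -[mul' (mul' v _) (phi (scal i 1))]tmulA' -phiM (cscalM hS hc) //.
  by rewrite mulr1.
have nK : cancel n m.
  move=> c; apply: (cscal_inj hS hc iE); apply: phi_inj; rewrite -mE psiK -nE.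
  rewrite !tmulA' uv -!tmulA' uv -!phiM !(cscalM hS hc) //.
  by rewrite mulr1 mul1r.
have mK : cancel m n.
  move=> d; apply: (cscal_inj hS hc' kE); rewrite -nE -mE psiK.
  rewrite !tmulA' vu -!tmulA' vu !(cscalM hS hc') //.
  by rewrite mulr1 mul1r.
have [nu nuE] := ring_aut_exists nB nM nK mK.
by exists nu => c; rewrite nuE.
Qed.

End Transfer.

Lemma transfer_mulM j l u u' v v' x y :
    corner_transfer j l u v -> mul x (scal j 1) = x ->
  mul' (mul' (mul' v' (phi x)) u) (mul' (mul' v (phi y)) u') =
    mul' (mul' v' (phi (mul x y))) u'.
Proof.
move=> tr xj; rewrite !tmulA' -[mul' (mul' (mul' v' _) u) v]tmulA'.
rewrite (transfer_uv tr) -[mul' (mul' v' _) (phi _)]tmulA' -phiM xj -tmulA'.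
by rewrite phiM !tmulA'.
Qed.

(** The image lies in a corner, hence is a monomial; it is nonzero because
    multiplying back by u on the left and v' on the right recovers phi(s). *)
Lemma transfer_mon i j k l u v u' v' s : i \in E -> j \in E ->
    corner_transfer i k u v -> corner_transfer j l u' v' ->
    corner i j s -> s != theta ->
  exists d t, [/\ d != 0, t != theta, corner k l t &
    mul' (mul' v (phi (mon 1 s))) u' = mon d t].
Proof.
move=> iE jE tri trj sij s0; have [is_ sj] := (cornerP hS s iE jE).1 sij.
set x := mul' _ u'.
have [d [t [tkl]]] := corner_mon hS hc' x (transferE tri) (transferE trj).
have -> : mul' (mul' (scal' k 1) x) (scal' l 1) = x.
  by rewrite /x !tmulA' (transfer_v tri) -[LHS]tmulA' (transfer_u trj).
move=> xE; have x0 : x != 0.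
  have m0 : mon 1 s != 0.
    apply: contra_neq (oner_neq0 D).
    by rewrite -(mon0 theta D s); apply: mon_injl.
  apply: contra_neq (phi_neq0 m0) => x0.
  have : mul' (mul' u x) v' = 0 by rewrite x0 tmulx0 tmul0x.
  rewrite /x !tmulA' (transfer_uv tri) -tmulA' (transfer_uv trj) -!phiM.
  rewrite (mul_cscal_mon hS hc) // mul1r (mul_mon_cscal hS hc) //.
  by rewrite rmorph1 mulr1.
have [d0 t0] : d != 0 /\ t != theta by apply: mon_neq0; rewrite -xE.
by exists d, t.
Qed.

(** Apply the maps x |-> v_i phi(x) u_j to the identity s d = alpha_s(d) s, with
    d a scalar in the corner of the target of s, and to the product of s and t
    in R, which is xi(s, t) (s t); then compare coefficients. *)
Lemma iso_pullback : exists p : S -> S,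
  [/\ forall s, s != theta -> p s != theta,
      forall s t, (s * t)%g != theta -> (p s * p t)%g = p (s * t)%g
    & exists nu h, intertwining theta E alpha (fun s => beta (p s)) xi
        (fun s t => zeta (p s) (p t)) nu h].
Proof.
have /choice[tr trP] : forall i, exists q : S * DS * DS * ring_aut D,
    i \in E -> corner_transfer i q.1.1.1 q.1.1.2 q.1.2 /\
      forall c, mul' (mul' q.1.2 (phi (scal i c))) q.1.1.2 =
        scal' q.1.1.1 (q.2 c).
  move=> i; have [iE|iE] := boolP (i \in E); last first.
    by exists (i, 0, 0, ring_aut1 D).
  have [k [u [v kuv]]] := corner_transfer_exists iE.
  by have [nu nuP] := transfer_aut iE kuv; exists (k, u, v, nu).
pose sg i := (tr i).1.1.1; pose u i := (tr i).1.1.2; pose v i := (tr i).1.2.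
pose nu i := (tr i).2.
have {}trP i : i \in E -> corner_transfer i (sg i) (u i) (v i) /\
    forall c, mul' (mul' (v i) (phi (scal i c))) (u i) = scal' (sg i) (nu i c).
  exact: trP.
pose F i j x := mul' (mul' (v i) (phi x)) (u j).
have [lr lrP] := corner_ends hS.
have /choice[q qP] : forall s, exists q : D * S, s != theta ->
    [/\ q.1 != 0, q.2 != theta, corner (sg (lr s).1) (sg (lr s).2) q.2 &
      F (lr s).1 (lr s).2 (mon 1 s) = mon q.1 q.2].
  move=> s; have [s0|s0] := eqVneq s theta; first by exists (0, s); rewrite s0.
  have [lE rE slr] := lrP s.
  have [tril _] := trP _ lE; have [trir _] := trP _ rE.
  have [d [t dtP]] := transfer_mon lE rE tril trir slr s0.
  by exists (d, t).
pose h s := (q s).1; pose p s := (q s).2.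
have hpP i j s : i \in E -> j \in E -> corner i j s -> s != theta ->
    [/\ h s != 0, p s != theta, corner (sg i) (sg j) (p s) &
      F i j (mon 1 s) = mon (h s) (p s)].
  move=> iE jE sij s0; have [lE rE slr] := lrP s.
  have [<- <-] := corner_uniq hS lE iE rE jE slr sij s0; exact: qP.
have F_coef i j s c : i \in E -> j \in E -> corner i j s -> s != theta ->
    F i j (mon c s) = mon (nu i c * h s) (p s).
  move=> iE jE sij s0; have [tri nuE] := trP i iE; have [trj _] := trP j jE.
  have [is_ sj] := (cornerP hS s iE jE).1 sij.
  have [_ _ psij FE] := hpP i j s iE jE sij s0.
  have [ips _] := (cornerP hS _ (transferE tri) (transferE trj)).1 psij.
  rewrite -[c]mulr1 -(mul_cscal_mon hS hc iE) //.
  rewrite /F -(transfer_mulM _ _ _ tri); last first.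
    by rewrite (cscalM hS hc) // mulr1.
  rewrite nuE -/(F i j _) FE (mul_cscal_mon hS hc' (transferE tri)) //.
  by rewrite mulr1.
have pM i j k s t : i \in E -> j \in E -> k \in E -> corner i j s ->
    corner j k t -> (s * t)%g != theta ->
    mon (h s * beta (p s) (h t) * zeta (p s) (p t)) (p s * p t)%g =
      mon (nu i (xi s t) * h (s * t)%g) (p (s * t)%g).
  move=> iE jE kE sij tjk st0; have [trj _] := trP j jE.
  have s0 := mul_neq0_l hS st0; have t0 := mul_neq0_r hS st0.
  have [_ sj] := (cornerP hS s iE jE).1 sij.
  have [_ _ _ FsE] := hpP i j s iE jE sij s0.
  have [_ _ _ FtE] := hpP j k t jE kE tjk t0.
  rewrite -(tmul_mon hS) -FsE -FtE -(F_coef i k) //; last first.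
    exact: cornerM sij tjk.
  rewrite /F (transfer_mulM _ _ _ trj).
    by rewrite (tmul_mon hS) rmorph1 !mul1r.
  by rewrite (mul_mon_cscal hS hc) // rmorph1 mulr1.
have p0 s : s != theta -> p s != theta.
  by move=> s0; have [lE rE slr] := lrP s; have [] := hpP _ _ _ lE rE slr s0.
have h0 s : s != theta -> h s != 0.
  by move=> s0; have [lE rE slr] := lrP s; have [] := hpP _ _ _ lE rE slr s0.
have nuh0 i s t : (s * t)%g != theta -> nu i (xi s t) * h (s * t)%g != 0.
  move=> st0; apply: division_mul_neq0 (h0 _ st0).
  exact/ring_aut_neq0/(cocycle2_neq0 hc).
exists p; split=> // [s t st0|].
  have [lE rE slr] := lrP s; have [lE' rE' tlr] := lrP t.
  have rl := corner_match hS rE lE' slr tlr st0; rewrite -rl in tlr.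
  have := pM _ _ _ _ _ lE rE rE' slr tlr st0 => /esym pE.
  by have [] := mon_inj (p0 _ st0) (nuh0 _ _ _ st0) pE.
exists nu, h; split=> // [i j s d iE jE sij s0|i j k s t iE jE kE sij tjk st0].
  have [is_ sj] := (cornerP hS s iE jE).1 sij.
  have [trj nujE] := trP j jE; have [tri _] := trP i iE.
  have [_ _ psij FsE] := hpP i j s iE jE sij s0.
  have [_ psj] := (cornerP hS _ (transferE tri) (transferE trj)).1 psij.
  apply: (mon_injl (p0 _ s0)); rewrite -(F_coef i j) //.
  rewrite -(mul_mon_cscal hS hc' (transferE trj)) // -FsE -nujE.
  rewrite /F (transfer_mulM _ _ _ trj); last first.
    by rewrite (mul_mon_cscal hS hc) // rmorph1 mulr1.
  by rewrite (mul_mon_cscal hS hc) // mul1r.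
have := pM _ _ _ _ _ iE jE kE sij tjk st0 => /esym pE.
by have [] := mon_inj (p0 _ st0) (nuh0 _ _ _ st0) pE.
Qed.

End Isomorphism.

(** * The criterion *)

Theorem corollary2p7 (S : semigroupType) (theta : S) (E : {pred S})
    (hS : square_free_semigroup theta E) (D : divisionRingType)
    (alpha : S -> ring_aut D) (xi : S -> S -> D)
    (hc : cocycle2 theta alpha xi) :
  is_D_algebra theta alpha xi <->
  exists zeta : S -> S -> center D,
    cocycle2_field theta zeta /\
    cohomologous theta E alpha xi
      (fun _ => ring_aut1 D) (fun s t => val (zeta s t)).
Proof.
split=> [[zeta [hz iso]]|[zeta [hz coh]]].
  have hz' := cocycle2_center hS hz.
  have := rng_isomorphic_trans iso (rng_isomorphic_sym (tensor_iso theta zeta)).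
  rewrite -!tmulE.
  move=> /rng_isomorphic_inv[phi [psi [phiB _ phiK psiK phiM]]].
  have [p [p0 pM [nu [h nuh]]]] := iso_pullback hS hc hz' phiB phiK psiK phiM.
  exists (fun s t => zeta (p s) (p t)); split; last first.
    exact: (intertwining_cohomologous hS nuh).
  split=> [s t st0|s t u stu0].
    by apply: (cocycle2_field_neq0 hz); rewrite pM // p0.
  have st0 := mul_neq0_l hS stu0.
  have tu0 : (t * u)%g != theta.
    by apply: (@mul_neq0_r _ _ _ hS s); rewrite mulgA.
  rewrite -!pM //; apply: (cocycle2_field_mul hz).
  by rewrite pM // pM // p0.
have [nu [h nuh]] := cohomologous_intertwining hS coh.
exists zeta; split=> //.
have := intertwining_iso hS nuh.
rewrite !tmulE => iso.
exact: rng_isomorphic_trans iso (tensor_iso theta zeta).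
Qed.
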